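(* Let $P$ be a fixed $m_1$-subspace of $R^n$ and let ${\cal M}'_R(m_1,m,n)$ be the set of all $m$-subspaces of $R^n$ containing $P$. Then ${\cal M}'_R(m_1,m,n)$ is non-empty if and only if $0\leq m_1\leq m\leq n$. Moreover, if it is non-empty, its size $N'_R(m_1,m,n)$ does not depend on the choice of $P$ and $$N'_R(m_1,m,n)=N_R(m-m_1,n-m_1)=\prod_{j=1}^{\ell}\prod_{i=0}^{m-m_1-1}\frac{|R_j|^{n-m_1-i}-|M_j|^{n-m_1-i}}{|R_j|^{m-m_1-i}-|M_j|^{m-m_1-i}},$$ where $N_R(a,b)$ denotes the number of $a$-subspaces of $R^b$.
   Context: $R$ is a finite commutative ring with identity $1\neq 0$, written as a direct product $R=R_1\times\cdots\times R_\ell$ of finite local rings $R_j$ with maximal ideals $M_j$. $R^n$ denotes the free module of row vectors of length $n$ over $R$. A set $\{\alpha_1,\dots,\alpha_m\}\subseteq R^n$ is unimodular if the $m\times n$ matrix with rows $\alpha_1,\dots,\alpha_m$ has a right inverse in $R^{n\times m}$. An $m$-subspace of $R^n$ is an $R$-submodule of $R^n$ having a basis of $m$ vectors which form a unimodular set; the $0$-subspace is $\{0\}$. *)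

(* Defs.v *)
From HB Require Import structures.
From mathcomp Require Import all_boot all_order all_algebra.

Set Implicit Arguments.
Unset Strict Implicit.
Unset Printing Implicit Defensive.

Import GRing.Theory.
Local Open Scope ring_scope.

(* [idealr_closed I] already says that [I] is a proper ideal: it includes     *)
(* [1 \notin I].                                                              *)
Definition maximal_ideal (A : finComNzRingType) (M : {set A}) : Prop :=
  idealr_closed M /\
  (forall I : {set A}, idealr_closed I -> M \subset I -> I = M).

Definition local_ring_with (A : finComNzRingType) (M : {set A}) : Prop :=
  maximal_ideal M /\ (forall I : {set A}, maximal_ideal I -> I = M).

(* The ring morphism x |-> (pi j x)_j from R to the product of the R_ j is an *)
(* isomorphism.                                                               *)
Definition is_direct_product (R : finComNzRingType) (l : nat)
    (R_ : 'I_l -> finComNzRingType)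
    (pi : forall j : 'I_l, {rmorphism R -> R_ j}) : Prop :=
  (forall x y : R, (forall j, pi j x = pi j y) -> x = y) /\
  (forall z : forall j, R_ j, exists x : R, forall j, pi j x = z j).

Section Subspaces.
Variables (R : finComNzRingType) (n : nat).
Implicit Types (V P : {set 'rV[R]_n}).

(* Finite families of row vectors are given as the rows of a matrix.          *)
Definition unimodular (m : nat) (A : 'M[R]_(m, n)) : bool :=
  [exists B : 'M[R]_(n, m), A *m B == 1%:M].

(* Boolean counterpart of [submod_closed].                                    *)
Definition is_submodule V : bool :=
  (0 \in V) &&
  [forall a : R, forall u in V, forall v in V, a *: u + v \in V].

Definition is_basis (m : nat) (A : 'M[R]_(m, n)) V : bool :=
  (V == [set \sum_(i < m) c 0 i *: row i A | c : 'rV[R]_m]) &&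
  [forall c : 'rV[R]_m, (\sum_(i < m) c 0 i *: row i A == 0) ==> (c == 0)].

Definition is_subspace (m : nat) V : bool :=
  is_submodule V &&
  [exists A : 'M[R]_(m, n), is_basis A V && unimodular A].

Definition subspaces (m : nat) : {set {set 'rV[R]_n}} :=
  [set V | is_subspace m V].

Definition subspaces_above P (m : nat) : {set {set 'rV[R]_n}} :=
  [set V in subspaces m | P \subset V].

End Subspaces.

Arguments subspaces R n m : clear implicits.

Definition num_subspaces (R : finComNzRingType) (a b : nat) : nat :=
  #|subspaces R b a|.

(* Main.v *)
Require Import Defs.
From HB Require Import structures.
From mathcomp Require Import all_boot all_order all_algebra.
From mathcomp Require Import fingroup perm.

Set Implicit Arguments.
Unset Strict Implicit.
Unset Printing Implicit Defensive.

Import GRing.Theory Num.Theory.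
Local Open Scope ring_scope.

(* A unimodular row over a finite local ring has a unit entry, so an invertible
   matrix T maps it to (1, 0, ..., 0); by gluing, the same holds over R, and by
   induction every unimodular m x n matrix A satisfies A T = (I | 0) for some
   invertible T. In these coordinates the k-row matrices D extending A to a
   unimodular matrix are the (D1 | D2) with D1 arbitrary and D2 unimodular, so
   there are |R|^(k m) U(k, n - m) of them, U(a, b) being the number of
   unimodular a x b matrices. Counting the extensions of a basis of P according
   to the (m1 + k)-subspace that they span, and cancelling |R|^(k m1), gives
   N'(m1, m1 + k, n) U(k, k) = U(k, n - m1). The case m1 = 0 identifies this
   number with N(k, n - m1). Finally U is multiplicative over the product, and
   over a local ring U(1, n) = |R_j|^n - |M_j|^n determines U recursively. *)

(** * Unimodular matrices over a finite commutative ring *)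

Section Unimodular.
Variable R : finComNzRingType.

Lemma unimodularP m n (A : 'M[R]_(m, n)) :
  reflect (exists B : 'M_(n, m), A *m B = 1%:M) (unimodular A).
Proof. by apply: (iffP existsP) => -[B /eqP AB]; exists B => //; apply/eqP. Qed.

Lemma unimodular_leq m n (A : 'M[R]_(m, n)) : unimodular A -> (m <= n)%N.
Proof. by case/unimodularP=> B; apply: mulmx1_min. Qed.

Lemma unimodular_mull m n p (A : 'M[R]_(m, n)) (B : 'M_(n, p)) :
  unimodular (A *m B) -> unimodular A.
Proof.
by case/unimodularP=> C ABC; apply/unimodularP; exists (B *m C); rewrite mulmxA.
Qed.

Lemma unimodularM m n p (A : 'M[R]_(m, n)) (B : 'M_(n, p)) :
  unimodular A -> unimodular B -> unimodular (A *m B).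
Proof.
case/unimodularP=> A' AA' /unimodularP[B' BB']; apply/unimodularP.
by exists (B' *m A'); rewrite mulmxA -(mulmxA A) BB' mulmx1.
Qed.

Lemma unimodular_usub m k n (A : 'M[R]_(m, n)) (D : 'M_(k, n)) :
  unimodular (col_mx A D) -> unimodular A.
Proof.
case/unimodularP=> B; rewrite -(hsubmxK B) mul_col_row scalar_mx_block.
by case/eq_block_mx=> AB _ _ _; apply/unimodularP; exists (lsubmx B).
Qed.

Lemma unimodular_pid m n : unimodular (pid_mx m : 'M[R]_(m, m + n)).
Proof.
apply/unimodularP; exists (col_mx 1%:M 0).
by rewrite pid_mx_row mul_row_col mul1mx mul0mx addr0.
Qed.

(** The identity block forces the upper right block of a right inverse to vanish, so its lower right
    block inverts [D]. Conversely, if [D *m B = 1], the block [- (B *m C)] cancels [C]. *)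
Lemma unimodular_block m k n (C : 'M[R]_(k, m)) (D : 'M_(k, n)) :
  unimodular (block_mx 1%:M 0 C D) = unimodular D.
Proof.
apply/unimodularP/unimodularP=> [[B]|[B DB]].
  rewrite -(submxK B) mulmx_block scalar_mx_block !mul1mx !mul0mx !addr0.
  case/eq_block_mx=> _ -> _; rewrite mulmx0 add0r => DB.
  by exists (drsubmx B).
exists (block_mx 1%:M 0 (- (B *m C)) B).
rewrite mulmx_block !mulmx1 !mul0mx !mulmx0 !addr0 !add0r.
by rewrite mulmxN mulmxA DB mul1mx subrr -scalar_mx_block.
Qed.

Lemma unimodular_mulr m n p (A : 'M[R]_(m, n)) (T : 'M_(n, p))
    (T' : 'M_(p, n)) :
  T *m T' = 1%:M -> unimodular (A *m T) = unimodular A.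
Proof.
move=> TT'; apply/idP/idP; first exact: unimodular_mull.
by move/unimodularM; apply; apply/unimodularP; exists T'.
Qed.

(** * Reduction of unimodular matrices to (I | 0) *)

Lemma pid_mx_recl m n :
  pid_mx m.+1 = block_mx 1%:M 0 0 (pid_mx m) :> 'M[R]_(1 + m, 1 + n).
Proof.
apply/matrixP=> i j.
case: (splitP i) => i' ei; case: (splitP j) => j' ej.
- have -> : i = lshift _ i' by apply/val_inj.
  have -> : j = lshift _ j' by apply/val_inj.
  by rewrite block_mxEul !mxE /= !ord1.
- have -> : i = lshift _ i' by apply/val_inj.
  have -> : j = rshift _ j' by apply/val_inj.
  by rewrite block_mxEur !mxE /= !ord1.
- have -> : i = rshift _ i' by apply/val_inj.
  have -> : j = lshift _ j' by apply/val_inj.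
  by rewrite block_mxEdl !mxE /= !ord1.
have -> : i = rshift _ i' by apply/val_inj.
have -> : j = rshift _ j' by apply/val_inj.
by rewrite block_mxEdr !mxE /= !add1n eqSS ltnS.
Qed.

(** This is the Hermite property: unimodular rows complete to invertible matrices. For square
    matrices over a commutative ring, [T *m T' = 1%:M] makes [T'] a two-sided inverse. *)
Definition hermite : Prop :=
  forall n (v : 'rV[R]_(1 + n)), unimodular v ->
  exists T T' : 'M_(1 + n), T *m T' = 1%:M /\ v *m T = row_mx 1%:M 0.

Definition completable m n (A : 'M[R]_(m, n)) : Prop :=
  exists T T' : 'M_n, T *m T' = 1%:M /\ A *m T = pid_mx m.

Lemma completable_step m n (A : 'M[R]_(1 + m, 1 + n)) :
    hermite -> (forall D : 'M_(m, n), unimodular D -> completable D) ->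
  unimodular A -> completable A.
Proof.
move=> hR IHm uA; have [T1 [T1' [T1K vT1]]] : exists T T' : 'M_(1 + n),
    T *m T' = 1%:M /\ usubmx A *m T = row_mx 1%:M 0.
  by apply: hR; apply: (@unimodular_usub _ _ _ _ (dsubmx A)); rewrite vsubmxK.
pose C := lsubmx (dsubmx A *m T1); pose D := rsubmx (dsubmx A *m T1).
have AT1 : A *m T1 = block_mx 1%:M 0 C D.
  by rewrite -[A]vsubmxK mul_col_mx vT1 -[dsubmx A *m T1]hsubmxK.
have uD : unimodular D.
  by rewrite -(unimodular_block C) -AT1 (unimodular_mulr _ T1K).
have [B DB] := unimodularP _ uD; have [T2 [T2' [T2K DT2]]] := IHm _ uD.
(* The lower left block of [A *m T1 *m T3] becomes [C - D *m B *m C = 0], while [T2] normalizes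
   [D]. *)
pose T3 : 'M_(1 + n) := block_mx 1%:M 0 (- (B *m C)) T2.
pose T3' : 'M_(1 + n) := block_mx 1%:M 0 (T2' *m (B *m C)) T2'.
exists (T1 *m T3), (T3' *m T1'); split.
  rewrite mulmxA -(mulmxA T1) [T3 *m T3']mulmx_block !mulmx1 !mul0mx !mulmx0.
  rewrite !addr0 !add0r (mulmxA T2) T2K mul1mx addrC subrr -scalar_mx_block.
  by rewrite mulmx1.
rewrite mulmxA AT1 [LHS]mulmx_block !mulmx1 !mul0mx !mulmx0 !addr0 !add0r DT2.
by rewrite mulmxN mulmxA DB mul1mx subrr -pid_mx_recl.
Qed.

Lemma hermite_completion m n (A : 'M[R]_(m, n)) :
  hermite -> unimodular A -> completable A.
Proof.
move=> hR; elim: m n A => [|m IHm] n A uA.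
  by exists 1%:M, 1%:M; rewrite mulmx1; split=> //; apply/matrixP=> -[].
case: n => [|n] in A uA *; first by have := unimodular_leq uA.
exact: (@completable_step m n A hR (IHm n) uA).
Qed.

(** * Counting unimodular matrices *)

Definition num_unimodular m n : nat := #|[set A : 'M[R]_(m, n) | unimodular A]|.

Definition extensions k m n (A : 'M[R]_(m, n)) : {set 'M[R]_(k, n)} :=
  [set D | unimodular (col_mx A D)].

Lemma card_extensions k m n (A : 'M[R]_(m, m + n)) : hermite -> unimodular A ->
  #|extensions k A| = (#|R| ^ (k * m) * num_unimodular k n)%N.
Proof.
move=> hR uA; have [T [T' [TK AT]]] := hermite_completion hR uA.
have T'K := mulmx1C TK.
(* [T'] undoes the change of coordinates that puts [A] in the form (I | 0). *)
pose f (p : 'M[R]_(k, m) * 'M[R]_(k, n)) := row_mx p.1 p.2 *m T'.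
have f_inj : injective f.
  move=> [C D] [C' D'] /(congr1 (mulmx^~ T)); rewrite /f /= -!mulmxA T'K !mulmx1.
  by case/eq_row_mx=> -> ->.
have -> : extensions k A = f @: setX setT [set D | unimodular D].
  apply/setP=> D; rewrite inE -(unimodular_mulr _ TK) mul_col_mx AT pid_mx_row.
  rewrite -[D *m T]hsubmxK unimodular_block.
  apply/idP/imsetP=> [uD | [[C D'] /[!inE] /= uD' ->]].
    exists (lsubmx (D *m T), rsubmx (D *m T)); first by rewrite !inE.
    by rewrite /f /= hsubmxK -mulmxA TK mulmx1.
  by rewrite /f /= -mulmxA T'K mulmx1 row_mxKr.
by rewrite card_imset // cardsX cardsT card_mx.
Qed.

Lemma num_unimodular_gt0 m n : (0 < num_unimodular m n)%N = (m <= n)%N.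
Proof.
apply/card_gt0P/idP=> [[A]|le_mn]; first by rewrite inE => /unimodular_leq.
by rewrite -(subnKC le_mn); exists (pid_mx m); rewrite inE unimodular_pid.
Qed.

Lemma num_unimodular0 n : num_unimodular 0 n = 1%N.
Proof.
rewrite -[RHS](expn0 #|R|) -[0%N in RHS](mul0n n) -card_mx -cardsT.
by congr #|pred_of_set _|; apply/setP=> A; rewrite !inE (flatmx0 A);
  rewrite -(flatmx0 (pid_mx 0)) (unimodular_pid 0).
Qed.

(** Matrices are grouped by their first [m] rows; by [card_extensions] all fibres have the same
    size. *)
Lemma num_unimodularD m k n : hermite ->
  num_unimodular (m + k) (m + n) =
  (num_unimodular m (m + n) * (#|R| ^ (k * m) * num_unimodular k n))%N.
Proof.
move=> hR; rewrite -[LHS]sum1_card.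
rewrite (partition_big usubmx [in [set A : 'M[R]_(m, m + n) | unimodular A]]) /=.
  rewrite -sum_nat_const; apply: eq_bigr => A; rewrite inE => uA.
  rewrite -(card_extensions k hR uA).
  rewrite sum1dep_card -[RHS](card_imset _ (can_inj (col_mxKd A))).
  apply: eq_card => D; rewrite !inE; apply/andP/imsetP=> [[uD /eqP <-]|].
    by exists (dsubmx D); rewrite ?inE vsubmxK.
  by case=> B /[!inE] uB ->; rewrite col_mxKu.
by move=> A; rewrite !inE -{1}[A]vsubmxK => /unimodular_usub.
Qed.

(** * Subspaces as row spans, and subspaces containing a given one *)

Definition rowspan m n (A : 'M[R]_(m, n)) : {set 'rV[R]_n} :=
  [set c *m A | c : 'rV[R]_m].

Lemma mem_rowspan m n (A : 'M[R]_(m, n)) c : c *m A \in rowspan A.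
Proof. exact: imset_f. Qed.

(** A right inverse of [A] recovers [c] from [c *m A], whence the rows of a unimodular matrix are
    linearly independent. *)
Lemma is_subspaceP m n (V : {set 'rV[R]_n}) :
  reflect (exists2 A : 'M_(m, n), unimodular A & V = rowspan A)
          (is_subspace m V).
Proof.
apply: (iffP andP) => [[_ /existsP[A /andP[/andP[/eqP defV _] uA]]]|[A uA ->]].
  by exists A; rewrite // defV; apply: eq_imset => c; rewrite mulmx_sum_row.
split.
  apply/andP; split; first by apply/imsetP; exists 0; rewrite ?mul0mx.
  apply/forallP=> a; apply/forall_inP=> _ /imsetP[c _ ->].
  apply/forall_inP=> _ /imsetP[d _ ->]; apply/imsetP.
  by exists (a *: c + d); rewrite // mulmxDl -scalemxAl.
apply/existsP; exists A; rewrite uA andbT; apply/andP; split.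
  by apply/eqP/eq_imset => c; rewrite mulmx_sum_row.
apply/forallP=> c; rewrite -mulmx_sum_row; apply/implyP=> /eqP cA0.
by have [B AB] := unimodularP _ uA; rewrite -[c]mulmx1 -AB mulmxA cA0 mul0mx.
Qed.

Lemma rowspan_subP m k n (A : 'M[R]_(m, n)) (B : 'M_(k, n)) :
  reflect (exists C, A = C *m B) (rowspan A \subset rowspan B).
Proof.
apply: (iffP subsetP) => [sAB | [C -> _ /imsetP[c _ ->]]]; last first.
  by rewrite mulmxA mem_rowspan.
have {}sAB i : exists c, row i A = c *m B.
  have /imsetP[c _ ->] : row i A \in rowspan B; last by exists c.
  by apply: sAB; rewrite rowE mem_rowspan.
have [c cE] := fin_all_exists sAB.
by exists (\matrix_i c i); apply/row_matrixP=> i; rewrite row_mul rowK.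
Qed.

(* Count the extensions of A to a basis, grouped by the subspace they span. *)
Lemma card_subspaces_above m k n (A : 'M[R]_(m, m + n)) :
  hermite -> unimodular A ->
  (#|subspaces_above (rowspan A) (m + k)| * num_unimodular k k)%N =
  num_unimodular k n.
Proof.
move=> hR uA; apply/eqP.
have q_gt0 : (0 < #|R| ^ (k * m))%N.
  by rewrite expn_gt0; apply/orP; left; apply/card_gt0P; exists 0.
rewrite -(eqn_pmul2l q_gt0) mulnCA -(card_extensions k hR uA).
rewrite -[#|extensions k A|]sum1_card.
rewrite (partition_big (fun D => rowspan (col_mx A D))
           [in subspaces_above (rowspan A) (m + k)]) /=; last first.
  move=> D; rewrite !inE => uD; apply/andP; split.
    by apply/is_subspaceP; exists (col_mx A D).
  by apply/rowspan_subP; exists (row_mx 1%:M 0);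
    rewrite mul_row_col mul1mx mul0mx addr0.
rewrite -sum_nat_const; apply/eqP/esym/eq_bigr => V; rewrite !inE.
case/andP=> /is_subspaceP[B uB ->] /rowspan_subP[C defA].
have uC : unimodular C by apply: (@unimodular_mull _ _ _ _ B); rewrite -defA.
(* In coordinates with respect to the basis [B] of [V], the extensions of [A] that span [V] become
   the extensions of [C] to an invertible square matrix. *)
rewrite -(card_extensions k hR uC) sum1dep_card.
have [B' BB'] := unimodularP _ uB.
have mulB_inj : injective (fun D : 'M_(k, m + k) => D *m B).
  by apply: (can_inj (g := mulmx^~ B')) => D; rewrite -mulmxA BB' mulmx1.
rewrite -[RHS](card_imset _ mulB_inj); apply: eq_card => D; rewrite !inE.
apply/andP/imsetP=> [[uD /eqP eqAD] | [D' /[!inE] uD' ->]].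
  have /rowspan_subP[G defG] : rowspan (col_mx A D) \subset rowspan B.
    by rewrite eqAD.
  have [_ defD] : A = usubmx G *m B /\ D = dsubmx G *m B.
    by apply/eq_col_mx; rewrite -mul_col_mx vsubmxK.
  exists (dsubmx G); rewrite // inE.
  by apply: (@unimodular_mull _ _ _ _ B); rewrite mul_col_mx -defA -defD.
rewrite defA -mul_col_mx unimodularM //; split=> //.
have [G' GG'] := unimodularP _ uD'.
rewrite eqEsubset; apply/andP; split; apply/rowspan_subP.
  by exists (col_mx C D').
(* [col_mx C D'] is square, so its right inverse [G'] is also a left inverse and recovers [B]. *)
by exists G'; rewrite mulmxA (mulmx1C GG') mul1mx.
Qed.

End Unimodular.

(** * Finite local rings *)

Section LocalRing.
Variables (A : finComNzRingType) (M : {set A}).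
Hypothesis local_A : local_ring_with M.

(** If [x] is not a unit, the multiples of [x] form a proper ideal. By finiteness it lies in a
    maximal ideal, which must be [M]. *)
Lemma local_unit (x : A) : x \notin M -> exists y, x * y = 1.
Proof.
have [_ maxM] := local_A; move=> xNM.
apply/existsPP; first by move=> y; apply: eqP.
apply: contraNT xNM => x_nu.
pose idealb (I : {set A}) := [&& 0 \in I, 1 \notin I &
  [forall a, forall u in I, forall v in I, a * u + v \in I]].
have idealP (I : {set A}) : reflect (idealr_closed I) (idealb I).
  apply: (iffP and3P) => [[I0 I1 /forallP IM]|[I0 I1 IM]]; split=> //.
    by move=> a u v uI vI; have /forall_inP/(_ u uI)/forall_inP/(_ v vI) := IM a.
  by apply/forallP=> a; apply/forall_inP=> u uI; apply/forall_inP=> v; apply: IM.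
have idx : idealb [set x * y | y : A].
  apply/idealP; split; first by apply/imsetP; exists 0; rewrite ?mulr0.
    apply: contra x_nu => /imsetP[y _ ->]; by apply/existsP; exists y.
  move=> a _ _ /imsetP[y _ ->] /imsetP[z _ ->]; apply/imsetP.
  by exists (a * y + z); rewrite // mulrDr mulrCA.
have [I /maxsetP[idI maxI] sxI] := maxset_exists idx.
rewrite -(maxM I).
  by apply: (subsetP sxI); apply/imsetP; exists 1; rewrite ?mulr1.
by split=> [|J /idealP idJ sIJ]; [apply/idealP | apply: maxI].
Qed.

Lemma local_unimodular_row n (v : 'rV[A]_n) :
  unimodular v = [exists i, v 0 i \notin M].
Proof.
have [[[M0 M1 MM] _] _] := local_A.
apply/unimodularP/existsP=> [[B vB] | [i /local_unit[y vy]]].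
  apply/existsP; apply: contraNT M1; rewrite negb_exists => /forallP vM.
  have -> : 1 = (v *m B) 0 0 by rewrite vB mxE.
  rewrite mxE; apply: (big_ind (fun x => x \in M)) => // [x y xM yM|i _].
    by rewrite -[x]mul1r MM.
  by rewrite mulrC -[_ * _]addr0 MM //; apply: negbNE.
exists (y *: delta_mx i 0); rewrite -scalemxAr -colE.
by apply/matrixP=> a b; rewrite !ord1 !mxE mulrC.
Qed.

(** The rows that are not unimodular are those with all entries in [M]. *)
Lemma local_num_unimodular_row n :
  (num_unimodular A 1 n)%:R = #|A|%:R ^+ n - #|M|%:R ^+ n :> rat.
Proof.
apply: (addIr (#|M|%:R ^+ n)); rewrite subrK -!natrX -natrD; congr _%:R.
have -> : (#|M| ^ n)%N = #|~: [set v : 'rV[A]_n | unimodular v]|.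
  have row_inj : injective (fun f : {ffun 'I_n -> A} => \row_i f i).
    by move=> f g /rowP fg; apply/ffunP=> i; have:= fg i; rewrite !mxE.
  rewrite -[n in LHS]card_ord -card_ffun_on -(card_imset _ row_inj).
  apply: eq_card => v; rewrite !inE local_unimodular_row negb_exists.
  apply/imsetP/forallP=> [[f /ffun_onP fM -> i]|vM].
    by rewrite mxE negbK.
  exists [ffun i => v 0 i]; last by apply/rowP=> i; rewrite mxE ffunE.
  by apply/ffun_onP=> i; rewrite ffunE; apply/negbNE.
by rewrite cardsC card_mx mul1n.
Qed.

(* One entry of a unimodular row is a unit; move it to the front and clear the
   others. *)
Lemma local_hermite : hermite A.
Proof.
move=> n v; rewrite local_unimodular_row => /existsP[i /local_unit[y vy]].
pose S : 'M[A]_(1 + n) := tperm_mx 0 i; pose w := v *m S.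
have SS : S *m S = 1%:M by rewrite /S /tperm_mx -perm_mxM tperm2 perm_mx1.
have wy : lsubmx w *m y%:M = 1%:M.
  apply/matrixP=> a b; rewrite !ord1 mul_mx_scalar mxE [RHS]mxE mxE mulrC -vy.
  rewrite /w -xcolE mxE; congr (v 0 _ * _).
  have -> : lshift n 0 = 0 :> 'I_(1 + n) by apply/val_inj.
  by rewrite tpermL.
(* [S] brings the unit entry to the front, [y] scales it to 1, and the upper right block subtracts
   the other entries. *)
exists (S *m block_mx y%:M (- (y%:M *m rsubmx w)) 0 1%:M).
exists (block_mx (lsubmx w) (rsubmx w) 0 1%:M *m S); split.
  rewrite mulmxA -(mulmxA S) mulmx_block !mul0mx !mulmx0 !mulmx1 !addr0 !add0r.
  by rewrite (mulmx1C wy) subrr -scalar_mx_block mulmx1.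
rewrite mulmxA -/w -{1}[w]hsubmxK mul_row_block !mulmx0 addr0 !mulmx1 wy.
by rewrite mulmxN mulmxA wy mul1mx addrC subrr.
Qed.

End LocalRing.

(** Splitting off the first row in both counts gives the factor for [i = 0]; the powers of [#|A|]
    cancel, and induction applies to [k - 1] and [n - 1]. *)
Lemma local_num_unimodular_ratio (A : finComNzRingType) (M : {set A}) k n :
    local_ring_with M -> (k <= n)%N ->
  (num_unimodular A k n)%:R / (num_unimodular A k k)%:R =
  \prod_(i < k) ((#|A|%:R ^+ (n - i) - #|M|%:R ^+ (n - i)) /
                 (#|A|%:R ^+ (k - i) - #|M|%:R ^+ (k - i))) :> rat.
Proof.
move=> locA; elim: k n => [|k IHk] [|n] //= le_kn.
- by rewrite big_ord0 !num_unimodular0 divr1.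
- by rewrite big_ord0 !num_unimodular0 divr1.
rewrite big_ord_recl -IHk //= !subn0 -!(local_num_unimodular_row locA).
rewrite -[n.+1]add1n -[k.+1]add1n !(num_unimodularD _ _ _ (local_hermite locA)).
rewrite !natrM -!mulf_div divff ?mul1r // pnatr_eq0 -lt0n expn_gt0.
by apply/orP; left; apply/card_gt0P; exists 0.
Qed.

(** * Transfer from the local factors to their product *)

Section DirectProduct.
Variables (R : finComNzRingType) (l : nat) (R_ : 'I_l -> finComNzRingType).
Variable pi : forall j : 'I_l, {rmorphism R -> R_ j}.
Hypothesis prod_R : is_direct_product pi.

Lemma glue_mx m n (X : forall j, 'M[R_ j]_(m, n)) :
  exists Y : 'M[R]_(m, n), forall j, map_mx (pi j) Y = X j.
Proof.
have [_ glue] := prod_R.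
have [Y YE] :=
  fin_all_exists (fun p : 'I_m * 'I_n => glue (fun j => X j p.1 p.2)).
exists (\matrix_(a, b) Y (a, b)) => j.
by apply/matrixP=> a b; rewrite !mxE YE.
Qed.

Lemma map_mx_pi_inj m n (X Y : 'M[R]_(m, n)) :
  (forall j, map_mx (pi j) X = map_mx (pi j) Y) -> X = Y.
Proof.
have [inj _] := prod_R; move=> eqXY; apply/matrixP=> a b; apply: inj => j.
by have /matrixP/(_ a b) := eqXY j; rewrite !mxE.
Qed.

(** Right inverses over the factors glue to a right inverse over [R]. *)
Lemma unimodular_pi m n (X : 'M[R]_(m, n)) :
  unimodular X = [forall j, unimodular (map_mx (pi j) X)].
Proof.
apply/unimodularP/forallP=> [[B XB] j | uX].
  by apply/unimodularP; exists (map_mx (pi j) B); rewrite -map_mxM XB map_mx1.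
have [B_ XB] := fin_all_exists (fun j => unimodularP _ (uX j)).
have [B BE] := glue_mx B_; exists B; apply: map_mx_pi_inj => j.
by rewrite map_mxM BE XB map_mx1.
Qed.

Lemma hermite_product : (forall j, hermite (R_ j)) -> hermite R.
Proof.
move=> hR_ n v; rewrite unimodular_pi => /forallP uv.
have [T_ TE] := fin_all_exists (fun j => hR_ j _ _ (uv j)).
have [T'_ {}TE] := fin_all_exists TE.
have [T defT] := glue_mx T_; have [T' defT'] := glue_mx T'_.
exists T, T'; split; apply: map_mx_pi_inj => j; have [TK vT] := TE j.
  by rewrite map_mxM defT defT' TK map_mx1.
by rewrite map_mxM defT vT map_row_mx map_mx1 map_mx0.
Qed.

Lemma num_unimodular_product m n :
  num_unimodular R m n = (\prod_j num_unimodular (R_ j) m n)%N.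
Proof.
rewrite -cardsXn.
pose f (X : 'M[R]_(m, n)) : {dffun forall j, 'M[R_ j]_(m, n)} :=
  [ffun j => map_mx (pi j) X].
have f_inj : injective f.
  by move=> X Y /ffunP eqXY; apply: map_mx_pi_inj => j;
    have := eqXY j; rewrite !ffunE.
rewrite -[LHS](card_imset _ f_inj); congr #|pred_of_set _|; apply/setP=> X.
apply/imsetP/setXnP=> [[Y uY -> j]|uX].
  by move: uY; rewrite !inE unimodular_pi ffunE => /forallP.
have [Y YE] := glue_mx X; exists Y; last by apply/ffunP=> j; rewrite ffunE YE.
rewrite inE unimodular_pi; apply/forallP=> j; rewrite YE.
by have := uX j; rewrite inE.
Qed.

End DirectProduct.

Theorem theorem4p3 (R : finComNzRingType) (l : nat)
    (R_ : 'I_l -> finComNzRingType)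
    (M_ : forall j : 'I_l, {set R_ j})
    (pi : forall j : 'I_l, {rmorphism R -> R_ j})
    (local_R_ : forall j : 'I_l, local_ring_with (M_ j))
    (prod_R : is_direct_product pi)
    (n m1 m : nat) (P : {set 'rV[R]_n}) (P_subspace : is_subspace m1 P) :
  (subspaces_above P m != set0 <-> [&& 0 <= m1, m1 <= m & m <= n]%N) /\
  (subspaces_above P m != set0 ->
     [/\ forall P' : {set 'rV[R]_n}, is_subspace m1 P' ->
           #|subspaces_above P' m| = #|subspaces_above P m|,
         #|subspaces_above P m| = num_subspaces R (m - m1) (n - m1)
       & (#|subspaces_above P m|)%:R =
         \prod_(j < l) \prod_(i < m - m1)
           ((#|R_ j|%:R ^+ (n - m1 - i) - #|M_ j|%:R ^+ (n - m1 - i)) /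
            (#|R_ j|%:R ^+ (m - m1 - i) - #|M_ j|%:R ^+ (m - m1 - i))) :> rat]).
Proof.
have hR : hermite R.
  by apply: (hermite_product prod_R) => j; apply: local_hermite.
have above_leq : subspaces_above P m != set0 -> (m1 <= m <= n)%N.
  case/set0Pn=> V; rewrite !inE => /andP[/is_subspaceP[B uB ->]].
  have [A uA ->] := is_subspaceP _ _ P_subspace.
  case/rowspan_subP=> C defA; rewrite (unimodular_leq uB) andbT.
  (* The coordinate matrix [C] of a basis of [P] inside [V] has size [m1] by [m], and inherits
     unimodularity from [A = C *m B]. *)
  apply: (@unimodular_leq _ _ _ C).
  by apply: (@unimodular_mull _ _ _ _ _ B); rewrite -defA.
have card_above (Q : {set 'rV[R]_n}) : is_subspace m1 Q -> (m1 <= m <= n)%N ->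
  (#|subspaces_above Q m| * num_unimodular R (m - m1) (m - m1))%N =
  num_unimodular R (m - m1) (n - m1).
  case/is_subspaceP=> A uA -> /andP[le_m1m le_mn].
  have le_m1n := leq_trans le_m1m le_mn.
  rewrite -{1}(subnKC le_m1m).
  move: (subnKC le_m1n) A uA; move: (n - m1)%N => n' <- A uA.
  exact: card_subspaces_above.
have U_gt0 : (0 < num_unimodular R (m - m1) (m - m1))%N.
  by rewrite num_unimodular_gt0.
split.
  split=> // le_m; have := card_above P P_subspace le_m.
  (* An empty family would make the count [num_unimodular R (m - m1) (n - m1)] zero, although it is
     positive. *)
  apply: contra_eqN => /eqP ->.
  rewrite cards0 mul0n eq_sym -lt0n num_unimodular_gt0; apply: leq_sub2r.
  by case/and3P: le_m.
move=> /above_leq le_m.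
have le_k : (m - m1 <= n - m1)%N by apply: leq_sub2r; case/andP: le_m.
split.
- by move=> P' subP'; apply/eqP; rewrite -(eqn_pmul2r U_gt0) !card_above.
- apply/eqP; rewrite -(eqn_pmul2r U_gt0) card_above //.
  (* The matrix without rows spans the zero subspace, which lies in every subspace; the same count
     above it gives all [(m - m1)]-subspaces. *)
  have u0 : unimodular (0 : 'M[R]_(0, 0 + (n - m1))).
    by apply/unimodularP; exists 0; apply/matrixP=> -[].
  rewrite -(card_subspaces_above (m - m1) hR u0) eqn_pmul2r // !add0n.
  apply/eqP/eq_card => V; rewrite !inE; case: is_subspaceP => //= -[A uA ->].
  by apply/rowspan_subP; exists 0; apply/matrixP=> -[].
transitivity ((num_unimodular R (m - m1) (n - m1))%:R /
              (num_unimodular R (m - m1) (m - m1))%:R : rat).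
  by rewrite -(card_above P) // natrM mulfK // pnatr_eq0 -lt0n.
rewrite !(num_unimodular_product prod_R) !natr_prod -prodf_div.
by apply: eq_bigr => j _; apply: local_num_unimodular_ratio.
Qed.
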